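(* Let $X,Y\ge0$ be random variables with probability density functions $f_X\ge0$ and $f_Y>0$ on $(0,\infty)$, and let $L_X(x)=\int_0^\infty f_X(t)e^{-tx}\,dt$, $L_Y(x)=\int_0^\infty f_Y(t)e^{-tx}\,dt$ $(x>0)$. If one of the conditions (i) $t\mapsto f_X(t)/f_Y(t)$ is increasing (resp. decreasing) on $(0,\infty)$; (ii) there exists $t^*\in(0,\infty)$ such that $t\mapsto f_X(t)/f_Y(t)$ is increasing (resp. decreasing) on $(0,t^* )$ and decreasing (resp. increasing) on $(t^*,\infty)$, and $H_{L_X,L_Y}(0^+)\ge0$ (resp. $\le0$); holds, then $Y\le_{Lt-r}X$ (resp. $X\le_{Lt-r}Y$).
   Context: For a random variable $Z\ge0$ with distribution function $F_Z$, $L_Z(x)=\int_0^\infty e^{-tx}\,dF_Z(t)$, $x>0$. For random variables $X,Y\ge0$, $X\le_{Lt-r}Y$ means that $x\mapsto L_Y(x)/L_X(x)$ is decreasing on $(0,\infty)$. $H_{F,G}=\frac{F'}{G'}G-F$ and $H_{F,G}(0^+)=\lim_{x\to0^+}H_{F,G}(x)$. *)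

(* Defs.v *)
From HB Require Import structures.
From mathcomp Require Import all_boot all_order all_algebra.
From mathcomp Require Import all_classical all_reals all_analysis.
Set Implicit Arguments. Unset Strict Implicit. Unset Printing Implicit Defensive.
Import Order.TTheory GRing.Theory Num.Theory.
Import numFieldNormedType.Exports.
Local Open Scope classical_set_scope.
Local Open Scope ring_scope.

Section Defs.
Variable R : realType.

Definition is_pdf (f : R -> R) : Prop :=
  [/\ measurable_fun (`]0%R, +oo[ : set R) f,
      (forall t, 0 < t -> 0 <= f t) &
      (\int[lebesgue_measure]_(t in `]0%R, +oo[) (f t)%:E = 1)%E].

Definition Laplace (f : R -> R) (x : R) : R :=
  Rintegral lebesgue_measure `]0%R, +oo[ (fun t => f t * expR (- (t * x))).

Definition Lt_r_le (fX fY : R -> R) : Prop :=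
  forall x y, 0 < x -> x <= y ->
    Laplace fY y / Laplace fX y <= Laplace fY x / Laplace fX x.

Definition Hfun (F G : R -> R) (x : R) : R :=
  (derive1 F x / derive1 G x) * G x - F x.

Definition incr_on (P : R -> Prop) (g : R -> R) : Prop :=
  forall x y, P x -> P y -> x <= y -> g x <= g y.
Definition decr_on (P : R -> Prop) (g : R -> R) : Prop :=
  forall x y, P x -> P y -> x <= y -> g y <= g x.

End Defs.

(* Main.v *)
(** Write [p = L_X' / L_Y'] for the ratio of the Laplace transforms of
    [t * fX t] and [t * fY t], so that [H = p * L_Y - L_X] and
    [(L_X / L_Y)'] is a negative multiple of [H]. If [fX / fY] is increasing,
    [fX - c * fY] changes sign once, and comparing exponentials at that point
    shows that [L_X / L_Y] decreases. If [fX / fY] increases and then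
    decreases, [t * fX t - c * (t * fY t)] has sign pattern [-, +, -]; a positive
    combination of [exp (- x t)] and [exp (- z t)] that meets [exp (- y t)]
    at the two sign changes shows that [p] is quasi-concave. So, for each [x], either [p]
    increases on [(0, x]] and [H] too, whence [H x >= H 0+ >= 0], or
    [p] decreases on [[x, +oo)] and Cauchy's mean value theorem on [[x, n]] with
    [n -> oo] gives [L_X x <= p x * L_Y x]. Either way [H x >= 0].
    The other half is the same result for [- fX]. *)
Require Import Defs.
From mathcomp Require Import all_boot all_order all_algebra.
From mathcomp Require Import all_classical all_reals all_analysis.
From mathcomp Require Import measurable_realfun ring lra.
Import Order.TTheory GRing.Theory Num.Theory.
Import numFieldNormedType.Exports.
Local Open Scope classical_set_scope.
Local Open Scope ring_scope.

(** * Integrability and linearity of the Laplace integral *)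

Section LaplaceTransform.
Context {R : realType}.
Local Notation mu := (@lebesgue_measure R).
Local Notation D := (`]0%R, +oo[%classic : set R).
Implicit Types (f g h w : R -> R) (a b c s t x y z : R).

(** No sign is imposed on [h]: the class must contain the differences [g - c * w] and the negated
    density, and be stable under multiplication by [t]. *)
Definition laplace_integrable h : Prop := forall x, 0 < x ->
  mu.-integrable D (EFin \o (fun t => h t * expR (- (t * x)))).

Local Lemma pos_itvP t : D t <-> 0 < t.
Proof. by rewrite /= in_itv/= andbT. Qed.

(* The exceptional point is the mode of [fX / fY], at which the value of the
   ratio is unconstrained. *)
Lemma le_Rintegral_except1 c f g :
  mu.-integrable D (EFin \o f) -> mu.-integrable D (EFin \o g) ->
  (forall t, 0 < t -> t != c -> f t <= g t) ->
  \int[mu]_(t in D) f t <= \int[mu]_(t in D) g t.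
Proof.
move=> fi gi fg.
have mD : measurable (D `\ c) by exact: measurableD.
have E h : mu.-integrable D (EFin \o h) ->
    \int[mu]_(t in D) h t = \int[mu]_(t in D `\ c) h t.
  by move=> hi; rewrite /Rintegral (@negligible_integral _ _ _ mu D [set c])//=
    lebesgue_measure_set1.
rewrite !E//; apply: le_Rintegral => //.
- by apply: integrableS fi => //; exact: subIsetl.
- by apply: integrableS gi => //; exact: subIsetl.
by move=> t [/pos_itvP t0 /eqP tc]; exact: fg.
Qed.

Lemma measurable_expRM x (A : set R) :
  measurable_fun A (fun t => expR (- (t * x))).
Proof.
apply: measurableT_comp => //; apply: measurableT_comp => //.
exact: measurable_funM.
Qed.

Lemma laplace_integrable_pdf f : is_pdf f -> laplace_integrable f.
Proof.
move=> [mf f0 f1] x x0.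
have fi : mu.-integrable D (EFin \o f).
  apply/integrableP; split; first exact/measurable_EFinP.
  rewrite [ltLHS](_ : _ = 1%E) ?ltry// -f1; apply: eq_integral => t.
  by rewrite inE => /pos_itvP t0 /=; rewrite ger0_norm// f0.
apply: (le_integrable _ _ _ fi) => //=.
  by apply/measurable_EFinP/measurable_funM => //; exact: measurable_expRM.
move=> t /pos_itvP t0; rewrite lee_fin normrM (ger0_norm (expR_ge0 _)).
by rewrite ler_piMr// -expR0 ler_expR oppr_le0 mulr_ge0// ltW.
Qed.

(** Half of the exponent absorbs the factor [t]: since [1 + u <= exp u],
    [t * exp (- t x / 2) <= (x / 2)^-1], and the other half keeps [h] integrable. *)
Lemma laplace_integrable_moment h : laplace_integrable h ->
  laplace_integrable (fun t => t * h t).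
Proof.
move=> hi x x0; have x20 : 0 < x / 2 by rewrite divr_gt0.
have hi2 := hi _ x20.
have cM : mu.-integrable D (EFin \o (fun t =>
    (x / 2)^-1 * (h t * expR (- (t * (x / 2)))))).
  exact: (integrableZl _ (x / 2)^-1 hi2).
apply: (le_integrable _ _ _ cM) => //=.
  apply/measurable_EFinP.
  rewrite (_ : (fun _ => _) = (fun t => t * (h t * expR (- (t * x))))).
    apply: measurable_funM => //.
    by have /integrableP[/measurable_EFinP] := hi _ x0.
  by apply/funext => t; rewrite mulrA.
move=> t /pos_itvP t0; rewrite lee_fin !normrM -mulrA mulrCA [leRHS]mulrCA.
apply: ler_wpM2l => //.
rewrite !ger0_norm ?expR_ge0 ?invr_ge0 ?(ltW x20) ?(ltW t0)//.
rewrite (_ : - (t * x) = - (t * (x / 2)) + - (t * (x / 2))); last by field.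
rewrite expRD [leLHS]mulrA ler_wpM2r ?expR_ge0//.
rewrite expRN ler_pdivrMr ?expR_gt0// mulrC ler_pdivlMr//.
by apply: le_trans (expR_ge1Dx _); rewrite lerDr.
Qed.

Lemma laplace_integrableZ k h : laplace_integrable h ->
  laplace_integrable (fun t => k * h t).
Proof.
move=> hi x x0.
rewrite (_ : EFin \o _ = (fun t => k%:E * (h t * expR (- (t * x)))%:E)%E).
  by apply: integrableZl => //; exact: hi.
by apply/funext => t /=; rewrite -EFinM mulrA.
Qed.

Lemma laplace_integrableB g h : laplace_integrable g -> laplace_integrable h ->
  laplace_integrable (fun t => g t - h t).
Proof.
move=> gi hi x x0.
rewrite (_ : EFin \o _ = (fun t =>
    (g t * expR (- (t * x)))%:E - (h t * expR (- (t * x)))%:E)%E).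
  by apply: integrableB => //; [exact: gi|exact: hi].
by apply/funext => t /=; rewrite -EFinB mulrBl.
Qed.

Lemma LaplaceZ k h x : laplace_integrable h -> 0 < x ->
  Laplace (fun t => k * h t) x = k * Laplace h x.
Proof.
move=> hi x0; rewrite /Laplace -RintegralZl//; last exact: hi.
by apply: eq_Rintegral => t _; rewrite mulrA.
Qed.

Lemma LaplaceB g h x : laplace_integrable g -> laplace_integrable h -> 0 < x ->
  Laplace (fun t => g t - h t) x = Laplace g x - Laplace h x.
Proof.
move=> gi hi x0; rewrite /Laplace -RintegralB//; [|exact: gi|exact: hi].
by apply: eq_Rintegral => t _; rewrite mulrBl.
Qed.

(** * Derivative, limit at infinity and positivity of the transform *)

Lemma is_derive_Laplace h x : laplace_integrable h -> 0 < x ->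
  is_derive x 1 (Laplace h) (- Laplace (fun t => t * h t) x).
Proof.
move=> hi x0; have x20 : 0 < x / 2 by rewrite divr_gt0.
pose F := fun x t => h t * expR (- (t * x)).
pose G := fun t => `|t * h t * expR (- (t * (x / 2)))|.
have dF y t : is_derive y (1 : R) (F^~ t) (- (t * h t * expR (- (t * y)))).
  apply: is_derive_eq; rewrite /GRing.scale/=; ring.
have d1F y t : partial1of2 F y t = - (t * h t * expR (- (t * y))).
  by rewrite /partial1of2 derive1E; apply: derive_val.
have G0 t : 0 <= G t by exact: normr_ge0.
have Gi : mu.-integrable D (EFin \o G).
  exact: (integrable_norm (laplace_integrable_moment _ hi _ x20)).
(* The left end [x / 2] keeps the window away from 0, so that the single function [G] dominates the
   derivative for every parameter in it; the right end is arbitrary. *)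
have xI : `]x / 2, (x + 1)[%classic x.
  by rewrite /= in_itv/= ltrDl ltr01 andbT ltr_pdivrMr// ltr_pMr// ltr1n.
have Fi y : `]x / 2, (x + 1)[%classic y -> mu.-integrable D (EFin \o F y).
  by rewrite /= in_itv/= => /andP[xy _]; apply: hi; exact: lt_trans xy.
have Fd y t : `]x / 2, (x + 1)[%classic y -> D t -> derivable (F^~ t) y 1.
  by move=> _ _; exact: ex_derive.
have FG y t : `]x / 2, (x + 1)[%classic y -> D t -> `|partial1of2 F y t| <= G t.
  rewrite /= in_itv/= => /andP[xy _]; move/pos_itvP => t0.
  rewrite d1F normrN /G !normrM ler_wpM2l ?mulr_ge0// !ger0_norm ?expR_ge0//.
  by rewrite ler_expR lerN2 ler_pM2l// ltW.
apply: DeriveDef.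
  exact: (@derivable_under_integral _ _ _ mu F D (measurable_itv _) _ _ _
    xI Fi Fd _ G0 Gi FG).
rewrite -derive1E.
rewrite [LHS](@differentiation_under_integral _ _ _ mu F D (measurable_itv _) _ _ _
    xI Fi Fd _ G0 Gi FG).
under eq_Rintegral do rewrite d1F -mulN1r.
rewrite RintegralZl// ?mulN1r//.
exact: laplace_integrable_moment.
Qed.

(** Dominated convergence, with the integrand at parameter 1 as bound. Sampling at integers makes
    the pointwise limit that of a geometric sequence of ratio [exp (- t) < 1]. *)
Lemma cvg_Laplace0 h : laplace_integrable h ->
  Laplace h n.+1%:R @[n --> \oo] --> (0 : R).
Proof.
move=> hi.
suff : (\int[mu]_(t in D) (h t * expR (- (t * n.+1%:R)))%:E)%E @[n --> \oo]
    --> (\int[mu]_(t in D) (0 : R)%:E)%E.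
  by rewrite integral0; exact: fine_cvg.
pose F n t := (h t * expR (- (t * n.+1%:R)))%:E.
pose G t := `|(h t * expR (- (t * 1)))%:E|%E.
have mF n : measurable_fun D (F n).
  by have /integrableP[] := hi n.+1%:R (ltr0Sn _ _).
have m0 : measurable_fun D (fun=> (0 : R)%:E) by exact: measurable_cst.
have F0 : {ae mu, forall t, D t -> F^~ t @ \oo --> (0 : R)%:E}.
  apply: aeW => t /pos_itvP t0; apply: cvg_EFin; first exact: nearW.
  rewrite -(mulr0 (h t)); apply: cvgM; first exact: cvg_cst.
  rewrite [X in X @ _](_ : _ = (fun n => expR (- t) * (expR (- t)) ^+ n)).
    rewrite -(mulr0 (expR (- t))); apply: cvgM; first exact: cvg_cst.
    apply: cvg_expr; rewrite ger0_norm ?expR_ge0//.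
    by rewrite -[ltRHS]expR0 ltr_expR oppr_lt0.
  by apply/funext => n /=; rewrite -exprS -expRM_natr mulNr.
have Gi : mu.-integrable D G := integrable_abse (hi 1 ltr01).
have FG : {ae mu, forall t n, D t -> (`|F n t| <= G t)%E}.
  apply: aeW => t n /pos_itvP t0.
  rewrite /= lee_fin !normrM ler_wpM2l// !ger0_norm ?expR_ge0//.
  by rewrite ler_expR lerN2 ler_pM2l// ler1n.
by have [] := @dominated_convergence _ _ _ mu D (measurable_itv _)
  F (fun=> 0%:E) G mF m0 F0 Gi FG.
Qed.

(** A zero integral of a nonnegative function makes it vanish almost everywhere; the factors other
    than [f] are positive, so [f] would have mass 0 instead of 1. The weight [k] is 1 for the
    transform and [t] for its derivative. *)
Lemma Laplace_gt0 f k x : is_pdf f -> (forall t, 0 < t -> 0 < k t) ->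
  laplace_integrable (fun t => k t * f t) -> 0 < x ->
  0 < Laplace (fun t => k t * f t) x.
Proof.
move=> [mf f0 f1] k0 kfi x0; rewrite lt_neqAle; apply/andP; split; last first.
  apply: Rintegral_ge0 => t /pos_itvP t0.
  by rewrite !mulr_ge0 ?expR_ge0 ?f0// ltW// k0.
apply/eqP => L0.
have mi := measurable_int mu (kfi _ x0).
have I0 : (\int[mu]_(t in D) `|(k t * f t * expR (- (t * x)))%:E|)%E = 0%E.
  transitivity (\int[mu]_(t in D) (k t * f t * expR (- (t * x)))%:E)%E.
    apply: eq_integral => t; rewrite inE => /pos_itvP t0 /=.
    by rewrite ger0_norm// !mulr_ge0 ?expR_ge0 ?f0// ltW// k0.
  move: L0; rewrite /Laplace /Rintegral => L0.
  (* [Rintegral] is [fine] of the integral and [fine] sends infinities to 0, so finiteness is needed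
     before concluding. *)
  by rewrite -[LHS]fineK -?L0//; exact: integrable_fin_num (kfi _ x0).
have /(ae_eq_integral_abs mu (measurable_itv _) mi) aekf := I0.
have ae0 : ae_eq mu D (EFin \o f) (cst (0 : R)%:E).
  apply: filterS aekf => t /= + Dt => /(_ Dt)[] /eqP.
  move/pos_itvP : Dt => t0.
  by rewrite !mulf_eq0 expR_eq0 orbF (gt_eqF (k0 _ t0))/= => /eqP ->.
have mf' : measurable_fun D (EFin \o f) by exact/measurable_EFinP.
have m0 : measurable_fun D (cst (0 : R)%:E) by exact: measurable_cst.
have := @ae_eq_integral _ _ _ mu D _ _ (measurable_itv _) mf' m0 ae0.
by rewrite integral0 f1 => /eqP; rewrite eqe oner_eq0.
Qed.

(** * Convexity and integrals of functions with few sign changes *)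

(** Convexity with denominators cleared: the outer values lie above the tangent at [y], and the
    slope terms cancel in the weighted sum. *)
Lemma expR_convex3 k x y z : x <= y <= z ->
  (z - x) * expR (k * y) <= (z - y) * expR (k * x) + (y - x) * expR (k * z).
Proof.
move=> /andP[xy yz].
have tangent u : expR (k * y) * (1 + k * (u - y)) <= expR (k * u).
  rewrite (_ : k * u = k * y + k * (u - y)); last by ring.
  by rewrite expRD ler_wpM2l ?expR_ge0// expR_ge1Dx.
rewrite (_ : (z - x) * _ = (z - y) * (expR (k * y) * (1 + k * (x - y))) +
  (y - x) * (expR (k * y) * (1 + k * (z - y)))); last by ring.
by rewrite lerD// ler_wpM2l ?subr_ge0.
Qed.

(** Locates a sign change on an interval [I]: [s] is the infimum of the points of [I] satisfying
    [P], and nothing is claimed at [s] itself. The last clause serves to bound [s] from above. *)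
Lemma upward_closed_threshold a (I P : R -> Prop) :
  (forall t, I t -> a <= t) ->
  (forall t u, I t -> I u -> t <= u -> P t -> P u) ->
  (forall t, I t -> ~ P t) \/
  exists s, [/\ a <= s, forall t, I t -> t < s -> ~ P t,
    forall t, I t -> s < t -> P t & exists2 t, I t & s <= t].
Proof.
move=> aI up.
have [[t0 [It0 Pt0]]|nP] := pselect (exists t, I t /\ P t); last first.
  by left=> t It Pt; apply: nP; exists t.
right; pose S := [set t | I t /\ P t].
have lbS : lbound S a by move=> t [It _]; exact: aI.
have infS : has_inf S by split; [exists t0|exists a].
exists (inf S); split.
- by apply: lb_le_inf => //; exists t0.
- move=> t It ts Pt; move: ts; rewrite ltNge => /negP; apply.
  by apply: ge_inf; [exists a|].
- move=> t It st.
  have [] := @inf_adherent _ S (t - inf S) _ infS; first by rewrite subr_gt0.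
  move=> u [Iu Pu]; rewrite addrC subrK => ut.
  exact: up (ltW ut) Pu.
- by exists t0 => //; apply: ge_inf; [exists a|].
Qed.

Lemma Laplace_le0 h c x : laplace_integrable h -> 0 < x ->
  (forall t, 0 < t -> t != c -> h t <= 0) -> Laplace h x <= 0.
Proof.
move=> hi x0 h0; rewrite -(mul0r (Laplace h x)) -LaplaceZ//.
apply: (le_Rintegral_except1 c); [exact: hi| |move=> t t0 tc].
  exact: (laplace_integrableZ 0 _ hi).
by rewrite !mul0r mulr_le0_ge0 ?expR_ge0// h0.
Qed.

(** On either side of [s], [h t] and [exp (- t (y - x)) - exp (- s (y - x))] have opposite signs;
    multiply by [exp (- t x)] and integrate. *)
Lemma Laplace_one_sign_change h c s x y : laplace_integrable h ->
  0 < x -> x <= y ->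
  (forall t, 0 < t -> t != c -> t < s -> h t <= 0) ->
  (forall t, 0 < t -> t != c -> s < t -> 0 <= h t) ->
  Laplace h y <= expR (- (s * (y - x))) * Laplace h x.
Proof.
move=> hi x0 xy hneg hpos; have y0 := lt_le_trans x0 xy.
rewrite /Laplace -RintegralZl//; last exact: hi.
apply: (le_Rintegral_except1 c); [exact: hi| |move=> t t0 tc].
  rewrite (_ : EFin \o _ = (fun t =>
    (expR (- (s * (y - x))))%:E * (h t * expR (- (t * x)))%:E)%E)//.
  by apply: integrableZl => //; exact: hi.
rewrite (_ : - (t * y) = - (t * x) + - (t * (y - x))); last by ring.
rewrite expRD mulrA [leRHS]mulrC -subr_ge0 -mulrBr.
have e0 := expR_ge0 (- (t * x)).
have [ts|st|->] := ltgtP t s; last by rewrite subrr mulr0.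
- rewrite mulr_le0// ?mulr_le0_ge0 ?hneg// subr_le0 ler_expR lerN2.
  by rewrite ler_wpM2r ?subr_ge0// ltW.
- rewrite !mulr_ge0 ?hpos// subr_ge0 ler_expR lerN2.
  by rewrite ler_wpM2r ?subr_ge0// ltW.
Qed.

(** After factoring out [exp (- t y)], the integrand of the difference is [h * (1 - F)]. Convexity
    puts [F] below 1 between the sign changes and above 1 outside, so this product is
    nonnegative. *)
Lemma Laplace_two_sign_changes h c s1 s2 x y z : laplace_integrable h ->
  s1 < s2 -> 0 < x -> x < y -> y < z ->
  (forall t, 0 < t -> t != c -> t < s1 -> h t <= 0) ->
  (forall t, 0 < t -> t != c -> s1 < t -> t < s2 -> 0 <= h t) ->
  (forall t, 0 < t -> t != c -> s2 < t -> h t <= 0) ->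
  exists a b, [/\ 0 < a, 0 < b &
    a * Laplace h x + b * Laplace h z <= Laplace h y].
Proof.
move=> hi s12 x0 xy yz hneg1 hpos hneg2.
have y0 := lt_trans x0 xy; have z0 := lt_trans y0 yz.
(* [F] is convex and equals 1 exactly at the two sign changes of [h]. *)
pose u t := expR ((y - x) * t); pose v t := expR ((y - z) * t).
have u12 : u s1 < u s2 by rewrite /u ltr_expR ltr_pM2l// subr_gt0.
have v21 : v s2 < v s1 by rewrite /v ltr_expR ltr_nM2l// subr_lt0.
have u10 : 0 < u s1 by exact: expR_gt0.
have v20 : 0 < v s2 by exact: expR_gt0.
have d0 : 0 < u s2 * v s1 - u s1 * v s2.
  by rewrite subr_gt0 ltr_pM// ltW.
(* Cramer's rule for [F s1 = F s2 = 1]; the determinant is positive because [u] increases and [v]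
   decreases. *)
pose a := (v s1 - v s2) / (u s2 * v s1 - u s1 * v s2).
pose b := (u s2 - u s1) / (u s2 * v s1 - u s1 * v s2).
have a0 : 0 < a by rewrite divr_gt0// subr_gt0.
have b0 : 0 < b by rewrite divr_gt0// subr_gt0.
pose F t := a * u t + b * v t.
have F1 : F s1 = 1 by rewrite /F /a /b; field; rewrite gt_eqF.
have F2 : F s2 = 1 by rewrite /F /a /b; field; rewrite gt_eqF.
have Fconv p q r : p <= q <= r -> (r - p) * F q <= (r - q) * F p + (q - p) * F r.
  move=> pqr; have := expR_convex3 (y - x) _ _ _ pqr.
  have := expR_convex3 (y - z) _ _ _ pqr.
  rewrite -!/(u _) -!/(v _) => /(ler_wpM2l (ltW b0)) + /(ler_wpM2l (ltW a0)).
  rewrite /F; lra.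
exists a, b; split => //.
rewrite /Laplace -!RintegralZl//; [|exact: hi..].
have iZ k p : 0 < p ->
    mu.-integrable D (EFin \o (fun t => k * (h t * expR (- (t * p))))).
  move=> p0; rewrite (_ : EFin \o _ = (fun t =>
    k%:E * (h t * expR (- (t * p)))%:E)%E)//.
  by apply: integrableZl => //; exact: hi.
rewrite -RintegralD//; [|exact: iZ..].
apply: (le_Rintegral_except1 c); [|exact: hi|move=> t t0 tc].
  rewrite (_ : EFin \o _ = (fun t => (a * (h t * expR (- (t * x))))%:E +
    (b * (h t * expR (- (t * z))))%:E)%E)//.
  by apply: integrableD => //; exact: iZ.
have e0 := expR_ge0 (- (t * y)).
have -> : expR (- (t * x)) = expR (- (t * y)) * u t.
  by rewrite -expRD; congr expR; ring.
have -> : expR (- (t * z)) = expR (- (t * y)) * v t.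
  by rewrite -expRD; congr expR; ring.
rewrite -subr_ge0 (_ : _ - _ = expR (- (t * y)) * (h t * (1 - F t))); last first.
  by rewrite /F; ring.
rewrite mulr_ge0//.
have [ts1|s1t|->] := ltgtP t s1; last by rewrite F1 subrr mulr0.
  have /Fconv : t <= s1 <= s2 by rewrite !ltW.
  rewrite F1 F2 => Ft; rewrite mulr_le0// ?hneg1// subr_le0.
  by rewrite -(ler_pM2l (x := s2 - s1)) ?subr_gt0//; lra.
have [ts2|s2t|->] := ltgtP t s2; last by rewrite F2 subrr mulr0.
  have /Fconv : s1 <= t <= s2 by rewrite !ltW.
  rewrite F1 F2 => Ft; rewrite mulr_ge0// ?hpos// subr_ge0.
  by rewrite -(ler_pM2l (x := s2 - s1)) ?subr_gt0//; lra.
have /Fconv : s1 <= s2 <= t by rewrite !ltW.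
rewrite F1 F2 => Ft; rewrite mulr_le0// ?hneg2// subr_le0.
by rewrite -(ler_pM2l (x := s2 - s1)) ?subr_gt0//; lra.
Qed.

(** * Shape of a ratio of transforms inherited from the ratio of functions *)

Definition unimodal_on_pos (r : R -> R) : Prop := exists ts,
  [/\ 0 < ts, incr_on (fun t => 0 < t < ts) r & decr_on (fun t => ts < t) r].

(** Subtracting from [g] the multiple of [w] with the same transform at [x] leaves a function of
    sign pattern [-, +], whose transform is 0 at [x], hence nonpositive at [y]. *)
Lemma Laplace_ratio_decr g w : laplace_integrable g -> laplace_integrable w ->
  (forall t, 0 < t -> 0 < w t) -> (forall x, 0 < x -> 0 < Laplace w x) ->
  incr_on (fun t => 0 < t) (fun t => g t / w t) ->
  decr_on (fun x => 0 < x) (fun x => Laplace g x / Laplace w x).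
Proof.
move=> gi wi w0 Lw0 r_incr x y x0 y0 xy.
set c := Laplace g x / Laplace w x.
pose h t := g t - c * w t.
have hi : laplace_integrable h.
  by apply: laplace_integrableB => //; exact: laplace_integrableZ.
have LhE u : 0 < u -> Laplace h u = Laplace g u - c * Laplace w u.
  move=> u0; rewrite LaplaceB// ?LaplaceZ//; exact: laplace_integrableZ.
have Lhx : Laplace h x = 0 by rewrite LhE// divfK ?subrr// gt_eqF// Lw0.
rewrite ler_pdivrMr ?Lw0// -subr_le0 -LhE//.
have h_pos t : 0 < t -> (0 < h t) = (c < g t / w t).
  by move=> t0; rewrite subr_gt0 ltr_pdivlMr// w0.
have up t u : 0 < t -> 0 < u -> t <= u -> 0 < h t -> 0 < h u.
  by move=> t0 u0 tu; rewrite !h_pos// => /lt_le_trans; apply; exact: r_incr.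
have pos0 t : 0 < t -> 0 <= t by exact: ltW.
have [hle0|[s [_ hneg hpos _]]] := upward_closed_threshold _ _ _ pos0 up.
  (* The exceptional point 0 lies outside the domain and excludes nothing. *)
  apply: (@Laplace_le0 _ 0) => // t t0 _.
  by rewrite leNgt; apply/negP; exact: hle0.
apply: le_trans (@Laplace_one_sign_change h 0 s _ _ hi x0 xy _ _) _.
- by move=> t t0 _ ts; rewrite leNgt; apply/negP; exact: hneg.
- by move=> t t0 _ st; rewrite ltW// hpos.
by rewrite Lhx mulr0.
Qed.

(** With [c] the ratio at [y], the claim is that the transform of [h = g - c * w], which is 0 at
    [y], is nonpositive at [x] or at [z]. The cases are the degenerations of the pattern
    [-, +, -]. *)
Lemma Laplace_ratio_quasiconcave g w x y z :
  laplace_integrable g -> laplace_integrable w ->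
  (forall t, 0 < t -> 0 < w t) -> (forall x, 0 < x -> 0 < Laplace w x) ->
  unimodal_on_pos (fun t => g t / w t) -> 0 < x -> x < y -> y < z ->
  Laplace g x / Laplace w x <= Laplace g y / Laplace w y \/
  Laplace g z / Laplace w z <= Laplace g y / Laplace w y.
Proof.
move=> gi wi w0 Lw0 [ts [ts0 r_incr r_decr]] x0 xy yz.
have y0 := lt_trans x0 xy; have z0 := lt_trans y0 yz.
set c := Laplace g y / Laplace w y.
pose h t := g t - c * w t.
have hi : laplace_integrable h.
  by apply: laplace_integrableB => //; exact: laplace_integrableZ.
have LhE u : 0 < u -> Laplace h u = Laplace g u - c * Laplace w u.
  by move=> u0; rewrite LaplaceB// ?LaplaceZ//; exact: laplace_integrableZ.
have Lhy : Laplace h y = 0 by rewrite LhE// divfK ?subrr// gt_eqF// Lw0.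
have ratioE u : 0 < u -> (Laplace g u / Laplace w u <= c) = (Laplace h u <= 0).
  by move=> u0; rewrite ler_pdivrMr ?Lw0// LhE// subr_le0.
rewrite !ratioE//.
have h_pos t : 0 < t -> (0 < h t) = (c < g t / w t).
  by move=> t0; rewrite subr_gt0 ltr_pdivlMr// w0.
have up1 t u : 0 < t < ts -> 0 < u < ts -> t <= u -> 0 < h t -> 0 < h u.
  move=> t0 u0 tu; rewrite !h_pos//; [|by case/andP : u0|by case/andP : t0].
  by move=> /lt_le_trans; apply; exact: r_incr.
have up2 t u : ts < t -> ts < u -> t <= u -> h t <= 0 -> h u <= 0.
  move=> tst tsu tu; rewrite !leNgt !h_pos ?(lt_trans ts0)// -!leNgt.
  by apply: le_trans; exact: r_decr.
have geI t : 0 < t < ts -> 0 <= t by case/andP => /ltW.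
have gtI t : ts < t -> ts <= t by exact: ltW.
(* If [h] is never positive before the mode, [s1 = ts] makes the last clause vacuous. *)
have [s1 [s1ts hneg1 hpos1]] : exists s1, [/\ s1 <= ts,
    forall t, 0 < t < ts -> t < s1 -> h t <= 0 &
    forall t, 0 < t < ts -> s1 < t -> 0 <= h t].
  have [hle0|[s [_ hneg hpos [u /andP[_ uts] su]]]] :=
    upward_closed_threshold _ _ _ geI up1.
    exists ts; split => // t tI.
      by move=> _; rewrite leNgt; apply/negP/hle0.
    by case/andP : tI => _ /lt_trans /[apply]; rewrite ltxx.
  exists s; split; first by rewrite (le_trans su)// ltW.
    by move=> t tI tss; rewrite leNgt; apply/negP/hneg.
  by move=> t tI st; rewrite ltW// hpos.
have hneg_left t : 0 < t -> t != ts -> t < s1 -> h t <= 0.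
  by move=> t0 tts ts1; apply: hneg1 => //; rewrite t0 (lt_le_trans ts1).
(* No final negative block: the pattern is [-, +], which settles [z]. *)
have [hgt0|[s2 [tss2 hpos2 hneg2 _]]] := upward_closed_threshold _ _ _ gtI up2.
  right; apply: le_trans (@Laplace_one_sign_change h ts s1 y z hi y0 (ltW yz)
    hneg_left _) _.
    move=> t t0; rewrite neq_lt => /orP[tts|tst] s1t.
      by apply: hpos1; rewrite ?t0.
    by apply: ltW; rewrite ltNge; apply/negP/hgt0.
  by rewrite Lhy mulr0.
have hneg_right t : 0 < t -> t != ts -> s2 < t -> h t <= 0.
  by move=> t0 tts s2t; apply: hneg2 => //; exact: le_lt_trans s2t.
(* Since [s1 <= ts <= s2], the case [s2 <= s1] leaves no positive block: [h <= 0] off [ts], which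
   settles [x]. *)
have [s12|s21] := ltP s1 s2; last first.
  left; apply: (@Laplace_le0 _ ts) => // t t0.
  rewrite neq_lt => /orP[tts|tst].
    by apply: hneg_left; rewrite ?lt_eqF// (lt_le_trans tts)// (le_trans tss2).
  by apply: hneg_right; rewrite ?gt_eqF// (le_lt_trans _ tst)// (le_trans s21).
have hmid t : 0 < t -> t != ts -> s1 < t -> t < s2 -> 0 <= h t.
  move=> t0; rewrite neq_lt => /orP[tts|tst] s1t ts2.
    by apply: hpos1 => //; rewrite t0.
  by apply: ltW; rewrite ltNge; apply/negP/hpos2.
have [a [b [a0 b0]]] := @Laplace_two_sign_changes h ts s1 s2 x y z hi s12 x0 xy yz
  hneg_left hmid hneg_right.
rewrite Lhy => ab; have [|Lx] := leP (Laplace h x) 0; first by left.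
right; rewrite -(pmulr_rle0 _ b0); apply: le_trans ab.
by rewrite lerDr ltW// mulr_gt0.
Qed.

(** * From quasi-concavity to the sign of [H] and the monotone ratio *)

(** One strict descent from [a] to [b <= x] keeps all later values at most [p b < p a]; so for
    [x <= c < d] the triple [a, c, d] leaves only [p d <= p c]. *)
Lemma quasiconcave_incr_or_decr (p : R -> R) :
  (forall x y z, 0 < x -> x < y -> y < z -> p x <= p y \/ p z <= p y) ->
  forall x, (forall a b, 0 < a -> a <= b -> b <= x -> p a <= p b) \/
    (forall a b, x <= a -> a <= b -> p b <= p a).
Proof.
move=> qc x.
have [|nincr] := pselect (forall a b, 0 < a -> a <= b -> b <= x -> p a <= p b).
  by left.
right; have [a [b [a0 ab bx pba]]] :
    exists a b, [/\ 0 < a, a < b, b <= x & p b < p a].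
  apply: contrapT => H; apply: nincr => a b a0; rewrite le_eqVlt.
  move=> /predU1P[->//|ab bx]; rewrite leNgt; apply/negP => pba.
  by apply: H; exists a, b.
have right_b d : b <= d -> p d <= p b.
  rewrite le_eqVlt => /predU1P[->//|bd].
  by have [|//] := qc _ _ _ a0 ab bd; rewrite leNgt pba.
move=> c d xc; rewrite le_eqVlt => /predU1P[->//|cd].
have bc := le_trans bx xc.
have [pac|//] := qc _ _ _ a0 (lt_le_trans ab bc) cd.
by have := le_lt_trans (le_trans pac (right_b _ bc)) pba; rewrite ltxx.
Qed.

Definition moment h t : R := t * h t.

Lemma derive1_Laplace h x : laplace_integrable h -> 0 < x ->
  derive1 (Laplace h) x = - Laplace (moment h) x.
Proof.
by move=> hi x0; rewrite derive1E; have [_ ->] := is_derive_Laplace h x hi x0.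
Qed.

Lemma Hfun_LaplaceE g f x : laplace_integrable g -> laplace_integrable f ->
  0 < x -> Hfun (Laplace g) (Laplace f) x =
  Laplace (moment g) x / Laplace (moment f) x * Laplace f x - Laplace g x.
Proof.
by move=> gi fi x0; rewrite /Hfun !derive1_Laplace// invrN mulrNN.
Qed.

Section ratio.
Variables g f : R -> R.
Hypotheses (gi : laplace_integrable g) (fi : laplace_integrable f).
Hypothesis f_gt0 : forall t, 0 < t -> 0 < f t.
Hypothesis Lf_gt0 : forall x, 0 < x -> 0 < Laplace f x.
Hypothesis Lmf_gt0 : forall x, 0 < x -> 0 < Laplace (moment f) x.

Let p x := Laplace (moment g) x / Laplace (moment f) x.
Let H := Hfun (Laplace g) (Laplace f).

Let HE x : 0 < x -> H x = p x * Laplace f x - Laplace g x.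
Proof. exact: Hfun_LaplaceE. Qed.

Lemma Laplace_cauchy_MVT x y : 0 < x -> x < y ->
  exists c, [/\ x < c, c < y & Laplace g x - Laplace g y =
    p c * (Laplace f x - Laplace f y)].
Proof.
move=> x0 xy.
have pos c : c \in `]x, y[ -> 0 < c.
  by rewrite in_itv/= => /andP[xc _]; exact: lt_trans xc.
have dL h : laplace_integrable h -> forall c, c \in `]x, y[ ->
    is_derive c 1 (Laplace h) (- Laplace (moment h) c).
  by move=> hi c /pos; exact: is_derive_Laplace.
have cL h : laplace_integrable h -> {within `[x, y], continuous (Laplace h)}.
  move=> hi; apply: derivable_within_continuous => c.
  rewrite in_itv/= => /andP[xc _].
  by have [] := is_derive_Laplace _ _ hi (lt_le_trans x0 xc).
have dLf0 c : c \in `]x, y[ -> - Laplace (moment f) c != 0.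
  by move=> /pos c0; rewrite oppr_eq0 gt_eqF// Lmf_gt0.
have [c cxy] := cauchy_MVT xy (cL _ gi) (cL _ fi) (dL _ gi) (dL _ fi) dLf0.
(* The increment of [Laplace f] is nonzero, so the quotient in Cauchy's theorem can be cleared. *)
have := differentiable_subr_neq0 xy (cL _ fi) (dL _ fi) dLf0.
rewrite invrN mulrNN => Lf0 E.
exists c; move: (cxy); rewrite in_itv/= => /andP[xc cy]; split => //.
by rewrite /p E -[X in _ * X]opprB mulrN divfK// opprB.
Qed.

Hypothesis r_unimodal : unimodal_on_pos (fun t => g t / f t).

(** The limit is taken in the extended reals, so [H] may tend to [+oo] at 0. *)
Lemma Hfun_ge0 l : (H x)%:E @[x --> 0^'+] --> l -> (0 <= l)%E ->
  forall x, 0 < x -> 0 <= H x.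
Proof.
move=> Hl l0 x x0.
have p_qc a b c : 0 < a -> a < b -> b < c -> p a <= p b \/ p c <= p b.
  move=> a0 ab bc; apply: Laplace_ratio_quasiconcave => //.
  - exact: laplace_integrable_moment.
  - exact: laplace_integrable_moment.
  - by move=> t t0; rewrite mulr_gt0// f_gt0.
  have [ts [ts0 r_incr r_decr]] := r_unimodal.
  (* The factors [t] cancel, so the moments have the same unimodal ratio. *)
  have mE t : 0 < t -> moment g t / moment f t = g t / f t.
    by move=> t0; rewrite /moment -mulf_div divff ?mul1r// gt_eqF.
  exists ts; split => //.
    move=> t u tI uI tu; rewrite !mE; [exact: r_incr| |].
      by case/andP : uI.
    by case/andP : tI.
  by move=> t u tI uI tu; rewrite !mE ?(lt_trans ts0)//; exact: r_decr.
have [p_incr|p_decr] := quasiconcave_incr_or_decr _ p_qc x.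
- suff : (l <= (H x)%:E)%E by rewrite -lee_fin; exact: le_trans.
  apply: (cvge_le _ Hl).
  near=> y; rewrite lee_fin.
  have y0 : 0 < y by near: y; exact: nbhs_right_gt.
  have yx : y < x by near: y; exact: nbhs_right_lt.
  rewrite !HE//; have [c [yc cx E]] := Laplace_cauchy_MVT y x y0 yx.
  have pyc : p y <= p c by apply: p_incr; rewrite // ltW.
  have pcx : p c <= p x by apply: p_incr; rewrite ?(lt_trans y0)// ltW.
  (* A discrete form of [H' = p' * L_Y]. *)
  have disc (px pc py fx fy gx gy : R) : gy - gx = pc * (fy - fx) ->
      px * fx - gx - (py * fy - gy) = (px - pc) * fx + (pc - py) * fy.
    move=> gE; rewrite (_ : px * fx - gx - (py * fy - gy) =
      px * fx - py * fy + (gy - gx)); last by ring.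
    by rewrite gE; ring.
  rewrite -subr_ge0 (disc _ _ _ _ _ _ _ E).
  by rewrite addr_ge0// mulr_ge0 ?subr_ge0// ltW// Lf_gt0.
- rewrite HE// subr_ge0.
  have LE n : x < n.+1%:R -> Laplace g x - Laplace g n.+1%:R <=
      p x * (Laplace f x - Laplace f n.+1%:R).
    move=> xn; have [c [xc cn E]] := Laplace_cauchy_MVT x n.+1%:R x0 xn.
    rewrite E ler_wpM2r//; last by apply: p_decr => //; exact: ltW.
    (* [f] is treated as changing sign at 0, where the exponential factor is 1: its transform
       decreases. *)
    have f_ge0 t : 0 < t -> t != 0 -> 0 < t -> 0 <= f t.
      by move=> t0 _ _; rewrite ltW// f_gt0.
    have vac t : 0 < t -> t != 0 -> t < 0 -> f t <= 0.
      by move=> t0 _ /(lt_trans t0); rewrite ltxx.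
    have := Laplace_one_sign_change f 0 0 x _ fi x0 (ltW xn) vac f_ge0.
    by rewrite mul0r oppr0 expR0 mul1r subr_ge0.
  have cg : Laplace g x - Laplace g n.+1%:R @[n --> \oo] --> Laplace g x.
    by rewrite -[X in _ --> X]subr0; apply: cvgB;
      [exact: cvg_cst|exact: cvg_Laplace0].
  have cf : p x * (Laplace f x - Laplace f n.+1%:R) @[n --> \oo] -->
      p x * Laplace f x.
    apply: cvgM; first exact: cvg_cst.
    by rewrite -[X in _ --> X]subr0; apply: cvgB;
      [exact: cvg_cst|exact: cvg_Laplace0].
  apply: (ler_cvg_to cg cf); near=> n; apply: LE.
  rewrite -natr1 ltr_wpDr//; near: n; exact: nbhs_infty_gtr.
Unshelve. all: by end_near. Qed.

(** By the quotient rule the derivative is [- (Laplace (moment f) / Laplace f ^+ 2) * H]. *)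
Lemma Laplace_ratio_decr_Hfun : (forall x, 0 < x -> 0 <= H x) ->
  decr_on (fun x => 0 < x) (fun x => Laplace g x / Laplace f x).
Proof.
move=> H0 x y x0 y0 xy; set q := fun x => Laplace g x / Laplace f x.
have dq c : 0 < c -> is_derive c 1 q
    (- (Laplace (moment f) c / Laplace f c ^+ 2 * H c)).
  move=> c0; have Lf0 : Laplace f c != 0 by rewrite gt_eqF// Lf_gt0.
  have Lmf0 : Laplace (moment f) c != 0 by rewrite gt_eqF// Lmf_gt0.
  have dg := is_derive_Laplace _ _ gi c0.
  have df := is_derive_Laplace _ _ fi c0.
  have dfV := is_deriveV (x := c) (v := 1) Lf0 df.
  apply: is_derive_eq.
  rewrite HE// /p /moment /GRing.scale/=; field.
  by rewrite Lf0 andbT.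
have pos c : c \in `]x, y[ -> 0 < c.
  by rewrite in_itv/= => /andP[xc _]; exact: lt_trans xc.
apply: (@ler0_derive1_le_cc _ q x y) => //; last 2 first.
- by rewrite in_itv/= xy lexx.
- by rewrite in_itv/= lexx.
- by move=> c /pos/dq[].
- move=> c /pos c0; rewrite derive1E; have [_ ->] := dq _ c0.
  by rewrite oppr_le0 mulr_ge0 ?H0// divr_ge0 ?sqr_ge0// ltW// Lmf_gt0.
- apply: derivable_within_continuous => c; rewrite in_itv/= => /andP[xc _].
  by have [] := dq _ (lt_le_trans x0 xc).
Qed.

End ratio.

(** * Application to densities and reflection [g] to [- g] *)

Lemma Laplace_pdf_gt0 f x : is_pdf f -> 0 < x -> 0 < Laplace f x.
Proof.
move=> pf x0; have E : f = (fun t => 1 * f t) by apply/funext => t; rewrite mul1r.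
rewrite E; apply: (@Laplace_gt0 f (fun=> 1)) => //; rewrite -E.
exact: laplace_integrable_pdf.
Qed.

Lemma Laplace_ratio_decr_incr_or_unimodal g f : is_pdf f ->
  (forall t, 0 < t -> 0 < f t) -> laplace_integrable g ->
  incr_on (fun t => 0 < t) (fun t => g t / f t) \/
  (unimodal_on_pos (fun t => g t / f t) /\ exists l : \bar R,
    ((Hfun (Laplace g) (Laplace f) x)%:E @[x --> 0^'+] --> l) /\ (0 <= l)%E) ->
  decr_on (fun x => 0 < x) (fun x => Laplace g x / Laplace f x).
Proof.
move=> pf f0 gi; have fi := laplace_integrable_pdf _ pf.
have Lf0 x : 0 < x -> 0 < Laplace f x by exact: Laplace_pdf_gt0.
have Lmf0 x : 0 < x -> 0 < Laplace (moment f) x.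
  apply: (Laplace_gt0 f id) => //; exact: laplace_integrable_moment.
case=> [r_incr|[r_uni [l [Hl l0]]]]; first exact: Laplace_ratio_decr.
by apply: Laplace_ratio_decr_Hfun => //; exact: (Hfun_ge0 _ _ _ _ _ _ _ _ _ Hl).
Qed.

Lemma Hfun_LaplaceN g f x : laplace_integrable g -> laplace_integrable f ->
  0 < x -> Hfun (Laplace (fun t => -1 * g t)) (Laplace f) x =
  - Hfun (Laplace g) (Laplace f) x.
Proof.
move=> gi fi x0; have mgi := laplace_integrable_moment _ gi.
rewrite !Hfun_LaplaceE//; last exact: laplace_integrableZ.
have -> : moment (fun t => -1 * g t) = (fun t => -1 * moment g t).
  by apply/funext => t; rewrite /moment mulrCA.
by rewrite !LaplaceZ//; ring.
Qed.

End LaplaceTransform.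

Theorem theorem4 (R : realType) (fX fY : R -> R) :
  is_pdf fX -> is_pdf fY -> (forall t, 0 < t -> 0 < fY t) ->
  let r := fun t => fX t / fY t in
  let H := Hfun (Laplace fX) (Laplace fY) in
  (( incr_on (fun t => 0 < t) r
     \/ (exists ts : R, 0 < ts
           /\ incr_on (fun t => 0 < t < ts) r
           /\ decr_on (fun t => ts < t) r
           /\ exists l : \bar R, ((H x)%:E @[x --> 0^'+] --> l) /\ (0 <= l)%E))
    -> Lt_r_le fY fX)
  /\
  (( decr_on (fun t => 0 < t) r
     \/ (exists ts : R, 0 < ts
           /\ decr_on (fun t => 0 < t < ts) r
           /\ incr_on (fun t => ts < t) r
           /\ exists l : \bar R, ((H x)%:E @[x --> 0^'+] --> l) /\ (l <= 0)%E))
    -> Lt_r_le fX fY).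
Proof.
move=> pX pY Y0 r H.
have Xi := laplace_integrable_pdf _ pX; have Yi := laplace_integrable_pdf _ pY.
split=> cond.
  have decr := Laplace_ratio_decr_incr_or_unimodal fX fY pY Y0 Xi.
  move=> x y x0 xy; apply: decr => //; last exact: lt_le_trans xy.
  case: cond => [|[ts [ts0 [rincr [rdecr lim]]]]]; first by left.
  by right; split => //; exists ts; split.
(* Negating [fX] negates both [r] and [H], which turns the second half into the first. *)
pose g t := -1 * fX t.
have gi : laplace_integrable g by exact: laplace_integrableZ.
have gE t : g t / fY t = - r t by rewrite /g -mulrA mulN1r.
have decr := Laplace_ratio_decr_incr_or_unimodal g fY pY Y0 gi.
move=> x y x0 xy; have y0 := lt_le_trans x0 xy.
(* The order concerns [Laplace fY / Laplace fX]; inverting positive quotients puts [fY] back in the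
   denominator. *)
rewrite -[leLHS]invf_div -[leRHS]invf_div lef_pV2 ?posrE ?divr_gt0//;
  [|exact: Laplace_pdf_gt0..].
have LgE z : 0 < z ->
    Laplace g z / Laplace fY z = - (Laplace fX z / Laplace fY z).
  by move=> z0; rewrite /g LaplaceZ// mulN1r mulNr.
rewrite -lerN2 -!LgE//; apply: decr => //.
case: cond => [rdecr|[ts [ts0 [rdecr [rincr [l [Hl l0]]]]]]].
  by left=> t u t0 u0 tu; rewrite !gE lerN2; exact: rdecr.
right; split.
  exists ts; split=> // t u tI uI tu; rewrite !gE lerN2.
    exact: rdecr.
  exact: rincr.
exists (- l)%E; split; last by rewrite oppe_ge0.
(* The identity for the negated [H] holds only at positive points, hence the comparison near
   [0^'+]. *)
apply: cvg_trans (cvgeN Hl); apply: near_eq_cvg; near=> z.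
by rewrite /= Hfun_LaplaceN.
Unshelve. all: by end_near. Qed.
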